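(* Let $A\in\mathbb{Z}^{m\times n}$ and let $A_B$ be its bouquet matrix. Then the Markov complexity of $A$ is greater than or equal to the Markov complexity of $A_B$: $m(A)\ge m(A_B)$.
   Context: For $A\in\mathbb{Z}^{m\times n}$ and $r\ge2$, the $r$-th Lawrence lifting $A^{(r)}$ is the $(rm+n)\times rn$ matrix with $r$ copies of $A$ on the block diagonal (zeros elsewhere in these block rows) and final block row $(I_n\ I_n\ \cdots\ I_n)$. Elements of $\operatorname{Ker}_{\mathbb{Z}}(A^{(r)})$ are identified with $r\times n$ integer matrices whose rows lie in $\operatorname{Ker}_{\mathbb{Z}}(A)$ and sum to zero; the type of such an element is its number of nonzero rows. For an integer matrix $M$ with $N$ columns, a Markov basis is a finite set $\mathcal{M}\subseteq\operatorname{Ker}_{\mathbb{Z}}(M)$ such that whenever $\mathbf{w},\mathbf{u}\in\mathbb{N}^N$ with $\mathbf{w}-\mathbf{u}\in\operatorname{Ker}_{\mathbb{Z}}(M)$ there exist $\mathbf{v}_1,\ldots,\mathbf{v}_p\in\mathcal{M}\cup(-\mathcal{M})$ with $\mathbf{w}-\sum_{i\le l}\mathbf{v}_i\in\mathbb{N}^N$ for all $l$ and $\mathbf{w}-\mathbf{u}=\sum_{i=1}^p\mathbf{v}_i$; it is minimal if no proper subset is a Markov basis. The universal Markov basis of $M$ is the union of all minimal Markov bases (vectors differing by sign identified). The Markov complexity $m(A)$ is the largest type of any element of the universal Markov basis of $A^{(r)}$, as $r\ge2$ varies. Bouquets. Let $A=[\mathbf{a}_1,\ldots,\mathbf{a}_n]$.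 Fix a matrix whose columns form a $\mathbb{Z}$-basis of $\operatorname{Ker}_{\mathbb{Z}}(A)$ and let the Gale transform $G(\mathbf{a}_i)$ be its $i$-th row. Call $i\neq j$ adjacent if some $\mathbf{v}\in\mathbb{Z}^m$ makes $\mathbf{v}\cdot A$ nonzero exactly in positions $i,j$; the bouquets are the classes of the equivalence relation on columns generated by adjacency. A bouquet is free if $G(\mathbf{a}_i)=\mathbf{0}$ for its columns, non-free otherwise (then its Gale transforms are nonzero and pairwise linearly dependent). For a bouquet $B$ define $\mathbf{c}_B\in\mathbb{Z}^n$: if $B$ is free, any nonzero vector with support $\{i:\mathbf{a}_i\in B\}$ and positive first nonzero coordinate; if non-free, pick $j$ with $G(\mathbf{a}_i)_j\neq0$ for all $\mathbf{a}_i\in B$, let $g=\gcd(G(\mathbf{a}_i)_j:\mathbf{a}_i\in B)$, $i_0$ the smallest index in $B$, $\varepsilon$ the sign of $G(\mathbf{a}_{i_0})_j$, and $(\mathbf{c}_B)_i=\varepsilon G(\mathbf{a}_i)_j/g$ for $\mathbf{a}_i\in B$, $0$ otherwise. Set $\mathbf{a}_B=\sum_i(\mathbf{c}_B)_i\mathbf{a}_i$. With bouquets $B_1,\ldots,B_q$, the bouquet matrix is $A_B=[\mathbf{a}_{B_1},\ldots,\mathbf{a}_{B_q}]\in\mathbb{Z}^{m\times q}$. *)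

(* Defs.v *)
From HB Require Import structures.
From mathcomp Require Import all_boot all_order all_algebra.
From mathcomp Require Import boolp classical_sets cardinality constructive_ereal.

Set Implicit Arguments.
Unset Strict Implicit.
Unset Printing Implicit Defensive.

Import Order.TTheory GRing.Theory Num.Theory.
Local Open Scope classical_set_scope.
Local Open Scope ring_scope.

Definition kerZ m n (A : 'M[int]_(m, n)) : set 'cV[int]_n :=
  [set u | A *m u = 0].

Definition nonneg n (u : 'cV[int]_n) : Prop := forall i, 0 <= u i 0.

Definition markov_basis m n (A : 'M[int]_(m, n)) (M : set 'cV[int]_n) : Prop :=
  [/\ finite_set M,
      M `<=` kerZ A
    & forall w u : 'cV[int]_n, nonneg w -> nonneg u -> kerZ A (w - u) ->
      exists s : seq 'cV[int]_n,
        [/\ forall v, v \in s -> M v \/ M (- v),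
            forall l, (l <= size s)%N -> nonneg (w - \sum_(v <- take l s) v)
          & w - u = \sum_(v <- s) v]].

Definition minimal_markov_basis m n (A : 'M[int]_(m, n))
    (M : set 'cV[int]_n) : Prop :=
  markov_basis A M /\ forall M', M' `<` M -> ~ markov_basis A M'.

(* Changing the sign of an element of a minimal Markov basis yields another   *)
(* minimal Markov basis, so this union contains both representatives of each  *)
(* vector up to sign.                                                         *)
Definition universal_markov_basis m n (A : 'M[int]_(m, n)) : set 'cV[int]_n :=
  \bigcup_(M in minimal_markov_basis A) M.

Definition lawrence m n r (A : 'M[int]_(m, n)) :
    'M[int]_(\sum_(i < r) m + n, \sum_(i < r) n) :=
  col_mx (\mxblock_(i < r, j < r) (if i == j then A else 0))
         (\mxrow_(i < r) (1%:M : 'M[int]_n)).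

(* The r x n matrix attached to u has (the transpose of) submxcol u i as its  *)
(* i-th row.                                                                  *)
Lemma kerZ_lawrence m n r (A : 'M[int]_(m, n))
    (u : 'cV[int]_(\sum_(i < r) n)) :
  kerZ (lawrence r A) u <->
  (forall i, kerZ A (submxcol u i)) /\ \sum_(i < r) submxcol u i = 0.
Proof.
have diagE : \mxblock_(i < r, j < r) (if i == j then A else 0) *m u =
             \mxcol_(i < r) (A *m submxcol u i).
  rewrite -{1}(submxcolK u) mul_mxblock_mxrow; apply/eq_mxcolP => i.
  rewrite (bigD1 i) //= eqxx big1 ?addr0 // => j /negbTE.
  by rewrite eq_sym => ->; rewrite mul0mx.
have sumE : \mxrow_(i < r) (1%:M : 'M[int]_n) *m u = \sum_(i < r) submxcol u i.
  rewrite -{1}(submxcolK u) mul_mxrow_mxcol.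
  by apply: eq_bigr => i _; rewrite mul1mx.
rewrite /kerZ /lawrence /= mul_col_mx diagE sumE; split=> [/eqP|[ker_u ->]].
  rewrite col_mx_eq0 => /andP[/eqP ker_u /eqP ->]; split=> // i.
  move: ker_u; rewrite -mxcol0 => /eq_mxcolP; exact.
apply/eqP; rewrite col_mx_eq0 eqxx andbT -mxcol0; apply/eqP/eq_mxcolP => i.
exact: ker_u.
Qed.

Definition lawrence_type n r (u : 'cV[int]_(\sum_(i < r) n)) : nat :=
  #|[set i : 'I_r | submxcol u i != 0]%SET|.

Definition markov_types m n (A : 'M[int]_(m, n)) : set nat :=
  [set t | exists r (u : 'cV[int]_(\sum_(i < r) n)),
     [/\ (2 <= r)%N, universal_markov_basis (lawrence r A) u
       & t = lawrence_type u]].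

(* The supremum in the extended integers: +oo if the types are unbounded, and *)
(* the default value 0 if there is no type at all, i.e., if kerZ A is zero.   *)
Definition markov_complexity m n (A : 'M[int]_(m, n)) : \bar int :=
  supremum (0 : \bar int)%E [set (t%:Z)%:E | t in markov_types A].

Lemma markov_complexity_le m n (A : 'M[int]_(m, n)) (x : \bar int) :
  (markov_complexity A <= x)%E <->
  (0 <= x)%E /\ forall t, markov_types A t -> ((t%:Z)%:E <= x)%E.
Proof.
rewrite /markov_complexity /supremum; set T := markov_types A.
have [T0|/set0P[_ [t0 Tt0 _]]] := eqVneq.
  split=> [x0|[//]]; split=> // t Tt; exfalso.
  suff : (@set0 (\bar int)) (t%:Z)%:E by [].
  by rewrite -T0; exists t.
have supT : supremums [set (t%:Z)%:E | t in T] !=set0.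
  have [/nat_supremums_neq0[s [ubs lubs]]|nb] := pselect (ubound T !=set0).
    exists (s%:Z)%:E; split=> [_ [t Tt <-]|[y|//|] uby].
    - by rewrite lee_fin lez_nat; exact: ubs.
    - have {}uby t : T t -> t%:Z <= y.
        by move=> Tt; rewrite -lee_fin; apply: uby; exists t.
      case: y uby => [y|y] uby; last by have := uby _ Tt0.
      by rewrite lee_fin lez_nat; apply: lubs => t /uby.
    - by have := uby _ (ex_intro2 _ _ t0 Tt0 erefl).
  exists +oo%E; split=> [_ [t Tt <-]|[y|//|] uby]; first exact: leey.
  - exfalso; apply: nb; exists `|y|%N => t Tt.
    have : ((t%:Z)%:E <= y%:E)%E by apply: uby; exists t.
    by rewrite lee_fin leEnat => ty; rewrite -lez_nat (le_trans ty) // abszE ler_norm.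
  - by have := uby _ (ex_intro2 _ _ t0 Tt0 erefl).
case: xgetP => [s _ [ubs lubs]|noS]; last by case: supT => s /noS.
split=> [sx|[_ ubx]]; last by apply: lubs => _ [t Tt <-]; exact: ubx.
have ub t : T t -> ((t%:Z)%:E <= x)%E.
  by move=> Tt; apply: le_trans sx; apply: ubs; exists t.
by split=> //; apply: le_trans (ub _ Tt0); rewrite lee_fin.
Qed.

Definition gale_matrix m n d (A : 'M[int]_(m, n)) (G : 'M[int]_(n, d)) : Prop :=
  (forall u : 'cV[int]_n, kerZ A u <-> exists x : 'cV[int]_d, u = G *m x) /\
  injective (fun x : 'cV[int]_d => G *m x).

Definition adjacent m n (A : 'M[int]_(m, n)) (i j : 'I_n) : Prop :=
  i != j /\
  exists v : 'rV[int]_m, forall k, ((v *m A) 0 k != 0) = (k == i) || (k == j).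

Lemma adjacent_sym m n (A : 'M[int]_(m, n)) i j :
  adjacent A i j -> adjacent A j i.
Proof.
move=> [ij [v vE]]; split; first by rewrite eq_sym.
by exists v => k; rewrite vE orbC.
Qed.

(* As adjacency is symmetric, its reflexive transitive closure connect is the *)
(* equivalence relation it generates.                                         *)
Definition bouquets m n (A : 'M[int]_(m, n)) : {set {set 'I_n}} :=
  equivalence_partition (connect (fun i j => `[< adjacent A i j >]))
                        [set: 'I_n]%SET.

Definition free_bouquet n d (G : 'M[int]_(n, d)) (B : {set 'I_n}) : Prop :=
  forall i, i \in B -> row i G = 0.

Definition free_cvec n (B : {set 'I_n}) (c : 'cV[int]_n) : Prop :=
  (forall i, (c i 0 != 0) = (i \in B)) /\
  exists i0 : 'I_n, 0 < c i0 0 /\ forall i : 'I_n, (i < i0)%N -> c i 0 = 0.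

Definition nonfree_cvec n d (G : 'M[int]_(n, d)) (B : {set 'I_n})
    (c : 'cV[int]_n) : Prop :=
  exists (j : 'I_d) (i0 : 'I_n),
    [/\ forall i, i \in B -> G i j != 0,
        i0 \in B /\ (forall i : 'I_n, i \in B -> (i0 <= i)%N)
      & let g := \big[gcdz/0]_(i in B) G i j in
        forall i, c i 0 =
          if i \in B then ((Num.sg (G i0 j) * G i j) %/ g)%Z else 0].

Definition bouquet_cvec n d (G : 'M[int]_(n, d)) (B : {set 'I_n})
    (c : 'cV[int]_n) : Prop :=
  (free_bouquet G B -> free_cvec B c) /\
  (~ free_bouquet G B -> nonfree_cvec G B c).

(* AB is a bouquet matrix of A for some choice of the kernel basis G, of the  *)
(* enumeration B of the bouquets, and of the vectors c.                       *)
Definition bouquet_matrix m n q (A : 'M[int]_(m, n)) (AB : 'M[int]_(m, q)) :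
    Prop :=
  exists d (G : 'M[int]_(n, d)) (B : q.-tuple {set 'I_n})
         (c : 'I_q -> 'cV[int]_n),
    [/\ gale_matrix A G,
        perm_eq B (enum (bouquets A)),
        forall k, bouquet_cvec G (tnth B k) (c k)
      & forall k, col k AB = \sum_(i < n) c k i 0 *: col i A].

(* Main.v *)
Require Import Defs.
From HB Require Import structures.
From mathcomp Require Import all_boot all_order all_algebra.
From mathcomp Require Import boolp classical_sets cardinality constructive_ereal.
From mathcomp Require Import zify ring.

(* Sending u to D u, (D u)_i = (c_B)_i u_B for i in B, identifies the kernel   *)
(* of A_B with that of A, and likewise for the Lawrence liftings, preserving   *)
(* types. We show that D maps the universal Markov basis of the lifting of A_B *)
(* into that of the lifting of A. Lawrence liftings have no nonzero            *)
(* nonnegative kernel vector, so z lies in a minimal Markov basis iff z+ and   *)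
(* z- are not joined, within their fiber, by a path whose consecutive points   *)
(* have intersecting supports: such a path makes z redundant, and without one  *)
(* z can be exchanged for an element of a minimal Markov basis. A path from    *)
(* (D z)+ to (D z)- projects to a path from z+ to z-, because every c_B has a  *)
(* positive entry; the intersections witnessed at negative entries of c_B are  *)
(* ruled out by the constancy of column sums on the fibers.                    *)

Set Implicit Arguments.
Unset Strict Implicit.
Unset Printing Implicit Defensive.

Import Order.TTheory GRing.Theory Num.Theory.
Local Open Scope classical_set_scope.
Local Open Scope ring_scope.

(** * Lattice walks *)

(** The universal Markov basis is described fiber by fiber: for a pointed kernel, a kernel vector
    [z] belongs to it exactly when [vpos z] and [vpos (- z)] are not [linked]
    ([minimal_markov_unlinked], [unlinked_universal_markov]). This criterion passes through a map
    that only repeats and rescales coordinates, since links after the map can be pulled back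
    ([linked_blowup]). Bouquets supply such a map: on each bouquet a kernel vector of A is an
    integer multiple of c_B ([bouquet_cvec_factor]). The map acts on liftings row by row and is
    injective, so every type occurring for A_B occurs for A. *)

Lemma kerZD m n (A : 'M[int]_(m, n)) u v :
  kerZ A u -> kerZ A v -> kerZ A (u + v).
Proof. by rewrite /kerZ /= mulmxDr => -> ->; rewrite addr0. Qed.

Lemma kerZN m n (A : 'M[int]_(m, n)) u : kerZ A u -> kerZ A (- u).
Proof. by rewrite /kerZ /= mulmxN => ->; rewrite oppr0. Qed.

Lemma kerZB m n (A : 'M[int]_(m, n)) u v :
  kerZ A u -> kerZ A v -> kerZ A (u - v).
Proof. by move=> ku kv; apply: kerZD => //; apply: kerZN. Qed.

Definition vpos n (v : 'cV[int]_n) : 'cV[int]_n := \col_i Num.max (v i 0) 0.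

Lemma nonneg_vpos n (v : 'cV[int]_n) : nonneg (vpos v).
Proof. by move=> i; rewrite mxE; lia. Qed.

Lemma vposB n (v : 'cV[int]_n) : vpos v - vpos (- v) = v.
Proof. by apply/colP => i; rewrite !mxE /=; lia. Qed.

Lemma nonnegD n (u v : 'cV[int]_n) : nonneg u -> nonneg v -> nonneg (u + v).
Proof. by move=> hu hv i; rewrite mxE addr_ge0. Qed.

Lemma nonneg_subvpos n (x v : 'cV[int]_n) :
  nonneg x -> nonneg (x - v) -> nonneg (x - vpos v).
Proof. by move=> hx hxv i; have := hx i; have := hxv i; rewrite !mxE /=; lia. Qed.

(** The path condition of [markov_basis] without partial sums ([walk_seqP]), so that concatenation,
    reversal and translation are plain inductions. *)
Inductive walk n (M : set 'cV[int]_n) : 'cV[int]_n -> 'cV[int]_n -> Prop :=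
| walk_refl w : nonneg w -> walk M w w
| walk_cons w v u :
    nonneg w -> M v \/ M (- v) -> walk M (w - v) u -> walk M w u.

Section Walk.
Variable n : nat.
Implicit Types (M N : set 'cV[int]_n) (u v w t : 'cV[int]_n).

Lemma walk_nonnegl M w u : walk M w u -> nonneg w.
Proof. by case. Qed.

Lemma walk_trans M w u t : walk M w u -> walk M u t -> walk M w t.
Proof.
elim=> // {w u} w v u w0 Mv _ IH /IH; exact: walk_cons.
Qed.

Lemma walk_sym M w u : walk M w u -> walk M u w.
Proof.
elim=> [{w u} w w0|{w u} w v u w0 Mv Mu IH]; first exact: walk_refl.
apply: walk_trans IH _; apply: (@walk_cons _ _ _ (- v)).
- exact: walk_nonnegl Mu.
- by rewrite opprK; case: Mv; [right|left].
- by rewrite opprK subrK; exact: walk_refl.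
Qed.

Lemma walkD M t w u : nonneg t -> walk M w u -> walk M (w + t) (u + t).
Proof.
move=> t0; elim=> [{w u} w w0|{w u} w v u w0 Mv _ IH].
  by apply: walk_refl; exact: nonnegD.
by apply: walk_cons Mv _; [exact: nonnegD|rewrite addrAC].
Qed.

Lemma walk_move M v : M v \/ M (- v) -> walk M (vpos v) (vpos (- v)).
Proof.
move=> Mv; apply: walk_cons Mv _; first exact: nonneg_vpos.
rewrite -{2}(vposB v) opprB addrC subrK; apply: walk_refl; exact: nonneg_vpos.
Qed.

(* A move v out of w is a translate of the move from vpos v to vpos (- v). *)
Lemma walk_replace M N w u :
  (forall v, M v -> walk N (vpos v) (vpos (- v))) -> walk M w u -> walk N w u.
Proof.
move=> MN; elim=> [{w u} w w0|{w u} w v u w0 Mv wu IH]; first exact: walk_refl.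
have t0 := nonneg_subvpos w0 (walk_nonnegl wu).
have Nv : walk N (vpos v) (vpos (- v)).
  by case: Mv => /MN //; rewrite opprK => /walk_sym.
have := walkD t0 Nv; rewrite addrC subrK => /walk_trans; apply.
suff -> : vpos (- v) + (w - vpos v) = w - v by [].
by rewrite -{3}(vposB v) opprB addrCA.
Qed.

Lemma walk_seqP M w u : nonneg u ->
  (exists s : seq 'cV[int]_n,
        [/\ forall v, v \in s -> M v \/ M (- v),
            forall l, (l <= size s)%N -> nonneg (w - \sum_(v <- take l s) v)
          & w - u = \sum_(v <- s) v]) <-> walk M w u.
Proof.
move=> u0; split=> [[s [Ms ws wuE]]|].
  elim: s w Ms ws wuE => [|v s IH] w Ms ws wuE.
    move: wuE; rewrite big_nil => /eqP; rewrite subr_eq0 => /eqP ->.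
    exact: walk_refl.
  apply: (@walk_cons _ _ _ v).
  - by have := ws 0 isT; rewrite take0 big_nil subr0.
  - by apply: Ms; rewrite mem_head.
  - apply: IH => [x xs|l ls|].
    + by apply: Ms; rewrite in_cons xs orbT.
    + by have := ws l.+1 ls; rewrite /= big_cons opprD addrA.
    + by rewrite addrAC wuE big_cons addrC addKr.
elim=> [{w u u0} w w0|{w u u0} w v u w0 Mv wu [s [Ms ws wuE]]].
  exists [::]; split=> // [l _|]; first by rewrite big_nil subr0.
  by rewrite big_nil subrr.
exists (v :: s); split=> [x|[|l] ls|].
- by rewrite in_cons => /predU1P[->|/Ms].
- by rewrite take0 big_nil subr0.
- by rewrite /= big_cons opprD addrA; apply: ws.
- by rewrite big_cons -wuE addrAC [RHS]addrC subrK.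
Qed.

End Walk.

Lemma markov_basisP m n (A : 'M[int]_(m, n)) (M : set 'cV[int]_n) :
  markov_basis A M <->
  [/\ finite_set M, M `<=` kerZ A
    & forall w u, nonneg w -> nonneg u -> kerZ A (w - u) -> walk M w u].
Proof.
split=> -[fM MA H]; split=> // w u w0 u0 /H-/(_ w0 u0);
  by move/(walk_seqP M w u0).
Qed.

(** Serves both to discard an element of a Markov basis and to exchange one for another. *)
Lemma markov_basis_replace m n (A : 'M[int]_(m, n)) (M N : set 'cV[int]_n) :
  finite_set N -> N `<=` kerZ A ->
  (forall v, M v -> walk N (vpos v) (vpos (- v))) ->
  markov_basis A M -> markov_basis A N.
Proof.
move=> fN NA MN /markov_basisP[_ _ H]; apply/markov_basisP; split=> // w u w0 u0.
by move/(H _ _ w0 u0); exact: walk_replace.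
Qed.

(** * Existence of Markov bases *)

(** Induction on [k]: a list found while ignoring the new coordinate serves every [s] whose new
    coordinate is at least the maximum over that list; the finitely many smaller values are treated
    slice by slice. *)
Lemma dickson (T : eqType) (k : nat) (f : T -> nat -> nat) (S : set T) :
  exists F : seq T, (forall x, x \in F -> S x) /\
    forall s, S s ->
      exists2 x, x \in F & forall i, (i < k)%N -> (f x i <= f s i)%N.
Proof.
elim: k S => [|k IH] S.
  have [[x Sx]|nS] := pselect (exists x, S x).
    exists [:: x]; split=> [y|s _]; first by rewrite inE => /eqP ->.
    by exists x; rewrite ?inE.
  by exists [::]; split=> // s Ss; case: nS; exists s.
have bounded N : exists F : seq T, (forall x, x \in F -> S x) /\
    forall s, S s -> (f s k < N)%N ->
      exists2 x, x \in F & forall i, (i < k.+1)%N -> (f x i <= f s i)%N.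
  elim: N => [|N [F [FS FP]]]; first by exists [::].
  have [F' [F'S F'P]] := IH [set s | S s /\ f s k = N].
  exists (F ++ F'); split=> [x|s Ss].
    by rewrite mem_cat => /orP[/FS|/F'S[]].
  rewrite ltnS leq_eqVlt => /predU1P[sN|/(FP _ Ss)[x xF xs]].
    have [//|x xF xs] := F'P s; exists x; first by rewrite mem_cat xF orbT.
    move=> i; rewrite ltnS leq_eqVlt => /predU1P[->|]; last exact: xs.
    by case: (F'S _ xF) => _ ->; rewrite sN.
  by exists x => //; rewrite mem_cat xF.
have [F [FS FP]] := IH S.
have [F' [F'S F'P]] := bounded (\max_(x <- F) f x k)%N.
exists (F ++ F'); split=> [x|s Ss].
  by rewrite mem_cat => /orP[/FS|/F'S].
have [/(F'P _ Ss)[x xF xs]|large] := ltnP (f s k) (\max_(x <- F) f x k).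
  by exists x => //; rewrite mem_cat xF orbT.
have [x xF xs] := FP _ Ss; exists x; first by rewrite mem_cat xF.
move=> i; rewrite ltnS leq_eqVlt => /predU1P[->|]; last exact: xs.
by apply: leq_trans large; rewrite (big_rem x) //= leq_maxl.
Qed.

(* Dickson's lemma on (v+, v-) yields finitely many kernel vectors such that  *)
(* every nonzero kernel vector dominates one of them conformally.             *)
Lemma markov_basis_exists m n (A : 'M[int]_(m, n)) :
  exists M, markov_basis A M.
Proof.
pose coord (v : 'cV[int]_n) (i : 'I_n + 'I_n) : nat :=
  match i with inl i => `|(vpos v i 0)%R|%N | inr i => `|(vpos (- v) i 0)%R|%N end.
pose f v (i : nat) :=
  if insub i is Some j then coord v (enum_val (A := {: 'I_n + 'I_n}) j)
  else 0%N.
have [F [FS FP]] := dickson #|{: 'I_n + 'I_n}| f [set v | kerZ A v /\ v != 0].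
exists [set` F]; apply/markov_basisP; split; first exact: finite_seq.
  by move=> v /= /FS[].
move=> w u; have [k] := ubnP (\sum_i `|((w - u) i 0)%R|)%N.
elim: k w => // k IH w; rewrite ltnS => wk w0 u0 kwu.
have [|wu0] := eqVneq (w - u) 0.
  by move/eqP; rewrite subr_eq0 => /eqP ->; apply: walk_refl.
have [x xF xs] : exists2 x : 'cV[int]_n, x \in F &
    forall i, (i < #|{: 'I_n + 'I_n}|)%N -> (f x i <= f (w - u)%R i)%N.
  exact: FP.
have [kx x0] := FS _ xF.
have le_coord i : (coord x i <= coord (w - u)%R i)%N.
  have := xs (enum_rank i) (ltn_ord _); rewrite /f.
  by case: insubP => [j _ /val_inj ->|]; rewrite ?ltn_ord // enum_rankK.
(* Conformality keeps [w - x] between [w] and [u] coordinatewise and brings it closer to [u] in the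
   l1 norm, the induction measure. *)
have conf i : (0 <= x i 0 <= (w - u) i 0) \/ ((w - u) i 0 <= x i 0 <= 0).
  have := le_coord (inl i); have := le_coord (inr i); rewrite /coord !mxE /=; lia.
have wx0 : nonneg (w - x).
  move=> i; have := conf i; have := w0 i; have := u0 i; rewrite !mxE /=; lia.
apply: (@walk_cons _ _ _ x) => //; first by left.
apply: IH => //; last by rewrite addrAC; apply: kerZB.
apply: leq_trans wk; rewrite addrAC.
have [i xi] : exists i, x i 0 != 0.
  apply/existsP; apply: contraNT x0 => /existsPn x0.
  by apply/eqP/colP => i; rewrite mxE; apply/eqP; rewrite -[_ == _]negbK.
rewrite (bigD1 i) //= [ltnRHS](bigD1 i) //= -addSn leq_add //.
  by have := conf i; rewrite !mxE /=; lia.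
by apply: leq_sum => j _; have := conf j; rewrite !mxE /=; lia.
Qed.

Lemma finite_set_minimal (T : eqType) (P : set T -> Prop) (M : set T) :
  finite_set M -> P M ->
  exists M', [/\ M' `<=` M, P M' & forall M'', M'' `<` M' -> ~ P M''].
Proof.
move=> /finite_seqP[s Ms].
have {Ms} : M `<=` [set` s] by rewrite Ms.
have [k] := ubnP (size s); elim: k s M => // k IH s M; rewrite ltnS => sk Ms PM.
have [[M' [M'M PM']]|noM] := pselect (exists M', M' `<` M /\ P M'); last first.
  by exists M; split=> // M' M'M PM'; apply: noM; exists M'.
have [x Mx nM'x] : exists2 x, M x & ~ M' x.
  apply: contrapT => nx; case: M'M => _; apply => x Mx.
  by apply: contrapT => nM'x; apply: nx; exists x.
have sx : x \in s by exact: Ms.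
have [||N [NM' PN minN]] := IH (rem x s) M' _ _ PM'.
- by rewrite size_rem //; case: (s) sx sk.
- move=> y M'y /=; have := Ms y (properW M'M M'y); rewrite /= => ys.
  have := perm_to_rem sx => /perm_mem/(_ y); rewrite ys inE.
  by case: eqP M'y => [->|] // _ _ /esym.
- by exists N; split=> //; apply: subset_trans NM' (properW M'M).
Qed.

Lemma minimal_markov_basis_sub m n (A : 'M[int]_(m, n)) M :
  markov_basis A M -> exists2 N, N `<=` M & minimal_markov_basis A N.
Proof.
move=> MA; have fM : finite_set M by case: MA.
by have [N [NM NA minN]] := finite_set_minimal fM MA; exists N.
Qed.

(** * Fibers and the universal Markov basis *)

(** Equivalently, no fiber contains two distinct comparable points. *)
Definition pointed m n (A : 'M[int]_(m, n)) : Prop :=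
  forall t, nonneg t -> kerZ A t -> t = 0.

(* The connected components of the graph on a fiber of A in which two points *)
(* are joined when their supports meet.                                      *)
Inductive linked m n (A : 'M[int]_(m, n)) (x : 'cV[int]_n) :
    'cV[int]_n -> Prop :=
| linked_refl : nonneg x -> linked A x x
| linked_rcons y z i : linked A x y -> nonneg z -> kerZ A (y - z) ->
    0 < y i 0 -> 0 < z i 0 -> linked A x z.

Section Fiber.
Variables (m n : nat) (A : 'M[int]_(m, n)).
Hypothesis ptA : pointed A.
Implicit Types (M N P : set 'cV[int]_n) (u v w x y z t : 'cV[int]_n).

Lemma linked_nonneg x y : linked A x y -> nonneg y.
Proof. by elim. Qed.

Lemma linked_ker x y : linked A x y -> kerZ A (x - y).
Proof.
elim=> [_|{}y z i _ kxy _ kyz _ _]; first by rewrite subrr /kerZ /= mulmx0.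
by rewrite -(subrKA y); apply: kerZD.
Qed.

(* By pointedness the fiber of w lies strictly below that of vpos z, where no  *)
(* move of a walk can be z or - z.                                            *)
Lemma walk_below M z t w u : M `<=` kerZ A -> nonneg t -> t != 0 ->
  kerZ A (vpos z - (w + t)) -> walk M w u -> walk (M `\ z) w u.
Proof.
move=> MA t0 tn0 + Mwu.
elim: Mwu => [{w u} w w0 _|{w u} w v u w0 Mv wu IH kzw]; first exact: walk_refl.
have kv : kerZ A v by case: Mv => /MA // /kerZN; rewrite opprK.
have nz x : kerZ A (x - (w + t)) -> nonneg (w - x) -> False.
  move=> kx wx0; move/eqP: tn0; apply.
  have : w - x + t = 0.
    apply: ptA; first exact: nonnegD.
    by have := kerZN kx; rewrite opprB addrAC.
  by move=> /colP e; apply/colP => i; have := e i; have := t0 i; have := wx0 i;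
     rewrite !mxE /=; lia.
have wv0 := nonneg_subvpos w0 (walk_nonnegl wu).
apply: (@walk_cons _ _ _ v) => //.
  case: Mv => [Mv|Mv]; [left|right]; split=> //= vz.
    by apply: nz kzw _; rewrite -vz.
  apply: (nz (vpos v)) => //.
  have -> : vpos v - (w + t) = v + (vpos z - (w + t)).
    by rewrite -vz -{2}(vposB v) addrA subrK.
  exact: kerZD.
apply: IH; have -> : vpos z - (w - v + t) = vpos z - (w + t) + v.
  by rewrite addrAC opprB addrCA addrC.
exact: kerZD.
Qed.

(** If two points of the fiber share coordinate [i], remove one unit there: the smaller points are
    joined by a walk of [M], which avoids [z] by [walk_below]. Restoring the unit shows that a chain
    of links makes [z] redundant. *)
Lemma minimal_markov_unlinked M z : minimal_markov_basis A M -> M z ->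
  ~ linked A (vpos z) (vpos (- z)).
Proof.
move=> [/[dup] MA /markov_basisP[fM MkA Mw] minM] Mz lz.
apply: (minM (M `\ z)).
  by split=> [v []//|]; move=> /(_ z Mz) [_]; apply.
apply: markov_basis_replace MA => [||v Mv].
- by apply: sub_finite_set fM => v [].
- by move=> v [/MkA].
have [->|/eqP vz] := eqVneq v z; last by apply: walk_move; left.
elim: lz => [|y y' i ly IH y'0 kyy' yi y'i].
  by apply: walk_refl; exact: nonneg_vpos.
apply: walk_trans IH _.
pose e : 'cV[int]_n := delta_mx i 0.
have e0 : nonneg e by move=> j; rewrite mxE; case: eqP.
have sube0 x : nonneg x -> 0 < x i 0 -> nonneg (x - e).
  move=> x0 xi j; have := x0 j; rewrite !mxE andbT /=.
  by case: eqP => [->|_] /=; lia.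
have y0 := linked_nonneg ly.
have : walk (M `\ z) (y - e) (y' - e).
  apply: (@walk_below _ _ e) => //.
  - by apply/eqP => /colP/(_ i); rewrite !mxE !eqxx.
  - by rewrite subrK; exact: linked_ker ly.
  - apply: Mw; [exact: sube0|exact: sube0|].
    by rewrite opprB addrA subrK.
by move=> /(walkD e0); rewrite !subrK.
Qed.

(* A step between points with disjoint supports is exactly s+ -> s-. *)
Lemma walk_linked_or_crossing P x y : P `<=` kerZ A -> walk P x y ->
  linked A x y \/ exists2 s, P s & kerZ A (x - vpos s).
Proof.
move=> PA Pxy.
have : linked A x x by apply: linked_refl; exact: walk_nonnegl Pxy.
move: {1 3 4}x => x0 lx.
elim: Pxy lx => [{x y} w w0 lw|{x y} w v u w0 Pv wu IH lw]; first by left.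
have wv0 := walk_nonnegl wu.
have kv : kerZ A v by case: Pv => /PA // /kerZN; rewrite opprK.
have [[i [wi wvi]]|disj] := pselect (exists i, 0 < w i 0 /\ 0 < (w - v) i 0).
  apply: IH; apply: linked_rcons lw wv0 _ wi wvi.
  by rewrite opprB addrC subrK.
have wE : w = vpos v.
  apply/colP => i; have := w0 i; have := wv0 i.
  have : ~ (0 < w i 0 /\ 0 < (w - v) i 0) by move=> h; apply: disj; exists i.
  by rewrite !mxE /=; lia.
right; have kx := linked_ker lw.
case: Pv => Pv; first by exists v => //; rewrite -wE.
exists (- v) => //; have -> : x0 - vpos (- v) = (x0 - w) + v; last exact: kerZD.
by rewrite wE -{3}(vposB v) addrA subrK.
Qed.

(* In the fiber of vpos s, the only edge that uses s joins s+ and s-. *)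
Lemma walk_avoid P s x y : P `<=` kerZ A -> kerZ A s ->
  kerZ A (x - vpos s) -> walk P x y ->
  let Q := P `\ s in
  walk Q x y \/
  [/\ walk Q x (vpos s) \/ walk Q x (vpos (- s))
    & walk Q (vpos s) y \/ walk Q (vpos (- s)) y].
Proof.
move=> PA ks + Pxy Q.
elim: Pxy => [{x y} w w0 _|{x y} w v u w0 Pv wu IH kx].
  by left; exact: walk_refl.
have wv0 := walk_nonnegl wu.
have kv : kerZ A v by case: Pv => /PA // /kerZN; rewrite opprK.
have {}IH : walk Q (w - v) u \/
  [/\ walk Q (w - v) (vpos s) \/ walk Q (w - v) (vpos (- s))
    & walk Q (vpos s) u \/ walk Q (vpos (- s)) u].
  by apply: IH; rewrite addrAC; exact: kerZB.
(* A point of the fiber of [vpos v'] from which [v'] can be subtracted dominates [vpos v'], so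
   pointedness forces equality. *)
have edge v' : kerZ A (w - vpos v') -> nonneg (w - v') -> w = vpos v'.
  move=> kv' w'0; apply/eqP; rewrite -subr_eq0; apply/eqP; apply: ptA => //.
  exact: nonneg_subvpos.
have [[vs|vs]|nvs] := pselect ((v = s) \/ (v = - s)).
- have wE : w = vpos s by apply: edge => //; rewrite -vs.
  have wvE : w - v = vpos (- s).
    by rewrite wE vs -{2}(vposB s) opprB addrC subrK.
  rewrite wvE in IH; right; split.
    by left; rewrite -wE; exact: walk_refl.
  by case: IH => [|[]//]; right.
- have wE : w = vpos (- s).
    apply: edge; rewrite -?vs //.
    have -> : w - vpos v = w - vpos s + s; last exact: kerZD.
    by rewrite vs -{3}(vposB s) addrA subrK.
  have wvE : w - v = vpos s.
    by rewrite wE vs opprK -{2}(vposB s) addrC subrK.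
  rewrite wvE in IH; right; split.
    by right; rewrite -wE; exact: walk_refl.
  by case: IH => [|[]//]; left.
have Qv : Q v \/ Q (- v).
  case: Pv => Pv; [left|right]; split=> //= vs; apply: nvs; first by left.
  by right; rewrite -vs opprK.
have wQ x : walk Q (w - v) x -> walk Q w x by exact: walk_cons.
case: IH => [/wQ|[[/wQ|/wQ] wl wr]]; first by left.
- by right; split=> //; left.
- by right; split=> //; right.
Qed.

(** A minimal subset [P] of a minimal Markov basis [S] that still joins [vpos z] to [vpos (- z)]
    contains some [s] acting in this very fiber, because the ends are not linked. Exchanging [s] for
    [z] keeps a Markov basis. *)
Lemma unlinked_universal_markov z : kerZ A z ->
  ~ linked A (vpos z) (vpos (- z)) -> universal_markov_basis A z.
Proof.
move=> kz nlz.
have [M0 M0A] := markov_basis_exists A.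
have [S _ [/[dup] SA /markov_basisP[fS SkA Sw] minS]] :=
  minimal_markov_basis_sub M0A.
have Sz : walk S (vpos z) (vpos (- z)).
  by apply: Sw; rewrite ?vposB //; exact: nonneg_vpos.
have [P [PS Pz minP]] :=
  finite_set_minimal (P := fun P => walk P (vpos z) (vpos (- z))) fS Sz.
have PkA : P `<=` kerZ A by exact: subset_trans PS SkA.
have [//|[s Ps kzs]] := walk_linked_or_crossing PkA Pz.
have Q_subset : P `\ s `<` P.
  by split=> [v []//|]; move=> /(_ s Ps) [_]; apply.
pose S' := z |` (S `\ s).
have sub_walk x y : walk (P `\ s) x y -> walk S' x y.
  by apply: walk_replace => v [Pv vs]; apply: walk_move; left; right; split=> //;
     exact: PS.
have zz' : walk S' (vpos z) (vpos (- z)) by apply: walk_move; left; left.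
(* By minimality of [P], its walks without [s] do not join the two ends of [z]; they attach these
   ends to opposite ends of [s], so the move [z] bridges the gap. *)
have S's : walk S' (vpos s) (vpos (- s)).
  have := walk_avoid PkA (PkA _ Ps) kzs Pz.
  have nQ := minP _ Q_subset.
  case=> [//|[[zs|zs'] [sz|s'z]]].
  - by case: nQ; exact: walk_trans zs sz.
  - apply: walk_trans (sub_walk _ _ (walk_sym zs)) _.
    by apply: walk_trans zz' (sub_walk _ _ (walk_sym s'z)).
  - apply: walk_trans (sub_walk _ _ sz) _.
    by apply: walk_trans (walk_sym zz') (sub_walk _ _ zs').
  - by case: nQ; exact: walk_trans zs' s'z.
have S'A : markov_basis A S'.
  apply: markov_basis_replace SA => [||v Sv].
  - by rewrite finite_setU; split; [exact: finite_set1|exact: finite_setD].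
  - by move=> v [->|[/SkA]].
  - have [->//|/eqP vs] := eqVneq v s.
    by apply: walk_move; left; right.
have [N NS' minN] := minimal_markov_basis_sub S'A.
(* Without [z], the basis [N] would lie in [S] minus [s], against the minimality of [S]. *)
exists N => //; apply: contrapT => nNz; apply: (minS N); last by case: minN.
have NSs v : N v -> S v /\ v <> s.
  by move=> Nv; case: (NS' v Nv) => // vz; case: nNz; rewrite -vz.
split=> [v /NSs[]//|SN].
by have [_] := NSs _ (SN _ (PS _ Ps)); apply.
Qed.

End Fiber.

(** * Blow-ups of coordinates *)

Lemma subvE n (u v : 'cV[int]_n) i : (u - v) i 0 = u i 0 - v i 0.
Proof. by rewrite !mxE. Qed.

(** For bouquets, [b i] is the index of the bouquet of column [i], and [g i] is the entry of its
    vector c_B at [i]. *)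
Definition blowup n q (b : 'I_n -> 'I_q) (g : 'I_n -> int) (u : 'cV[int]_q) :
  'cV[int]_n := \col_i (g i * u (b i) 0).

Lemma blowupD n q (b : 'I_n -> 'I_q) g u v :
  blowup b g (u + v) = blowup b g u + blowup b g v.
Proof. by apply/colP => i; rewrite !mxE mulrDr. Qed.

Lemma blowupB n q (b : 'I_n -> 'I_q) g u v :
  blowup b g (u - v) = blowup b g u - blowup b g v.
Proof. by apply/colP => i; rewrite !mxE mulrBr. Qed.

Lemma blowup0 n q (b : 'I_n -> 'I_q) g : blowup b g 0 = 0.
Proof. by apply/colP => i; rewrite !mxE mulr0. Qed.

Lemma blowup_sum n q (b : 'I_n -> 'I_q) g (I : finType) (F : I -> 'cV_q) :
  blowup b g (\sum_i F i) = \sum_i blowup b g (F i).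
Proof. exact: (big_morph _ (blowupD b g) (blowup0 b g)). Qed.

Lemma pos_scale_entry (c z y : int) : 0 < c ->
  Num.max (c * z) 0 - c * y = c * (Num.max z 0 - y).
Proof.
move=> c0; rewrite mulrBr; congr (_ - _).
by have [z0|z0] := lerP z 0; [rewrite max_r ?max_r|rewrite max_l ?max_l]; nia.
Qed.

(** A negative factor turns the positive part of [c * z] into a multiple of the negative part of
    [z], which is [|z|] minus the positive part. *)
Lemma neg_scale_entry (c z y : int) : c < 0 ->
  Num.max (c * z) 0 - c * y = (- c) * (`|z| - (Num.max z 0 - y)).
Proof.
move=> c0; have [z0|z0] := lerP z 0.
  by rewrite max_l ?max_r ?ler0_norm //; nia.
by rewrite max_r ?max_l ?gtr0_norm //; nia.
Qed.

(* kblow_pos lets the nonnegativity of u be read off coordinates of blowup u. *)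
Record kernel_blowup m n m' q (A : 'M[int]_(m, n)) (A' : 'M[int]_(m', q))
    (b : 'I_n -> 'I_q) (g : 'I_n -> int) : Prop := KernelBlowup {
  kblow_neq0 : forall i, g i != 0;
  kblow_pos : forall k, exists2 i, b i = k & 0 < g i;
  kblow_ker : forall u, kerZ A' u -> kerZ A (blowup b g u);
  kblow_surj : forall v, kerZ A v -> exists2 u, kerZ A' u & v = blowup b g u
}.

Section KernelBlowup.
Variables (m n m' q : nat) (A : 'M[int]_(m, n)) (A' : 'M[int]_(m', q)).
Variables (b : 'I_n -> 'I_q) (g : 'I_n -> int).
Hypothesis bg : kernel_blowup A A' b g.

Lemma blowup_eq0 u : blowup b g u = 0 -> u = 0.
Proof.
move=> /colP u0; apply/colP => k; have [i <- gi] := kblow_pos bg k.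
have /eqP := u0 i; rewrite !mxE mulf_eq0 (negPf (kblow_neq0 bg i)) /=.
by move/eqP.
Qed.

(** Abstracts the columns of the matrices attached to a lifting: their sums vanish on the kernel,
    and a negative scaling factor recurs in every row. *)
Variables (T : eqType) (column : 'I_q -> T).
Hypothesis column_sum : forall u, kerZ A' u ->
  forall t, \sum_(j | column j == t) u j 0 = 0.
Hypothesis column_neg : forall i j, g i < 0 -> column j = column (b i) ->
  exists2 i', b i' = j & g i' < 0.

(* Along a path of linked points from (Dz)+, the points p = (Dz)+ - D y shadow *)
(* points x = z+ - y of the fiber of z+. A coordinate with g > 0 shared by two *)
(* consecutive p's is shared by the x's; one with g < 0 measures |z| - x, and  *)
(* if x' met neither z+ nor x, then the column sums would force x = z+ and     *)
(* x' = z- on that column, so that |z| - x and |z| - x' have disjoint supports.*)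
Lemma linked_blowup z : kerZ A' z ->
  linked A (vpos (blowup b g z)) (vpos (- blowup b g z)) ->
  linked A' (vpos z) (vpos (- z)).
Proof.
move=> kz lDz.
pose inv p := exists y, [/\ kerZ A' y, p = vpos (blowup b g z) - blowup b g y
                          & linked A' (vpos z) (vpos z - y)].
suff [y [ky yE lz]] : inv (vpos (- blowup b g z)).
  suff yz : y = z by move: lz; rewrite yz -{3}(vposB z) opprB addrC subrK.
  apply/eqP; rewrite -subr_eq0; apply/eqP/blowup_eq0; rewrite blowupB.
  by rewrite -{1}(vposB (blowup b g z)) yE opprB addrAC subrr add0r subrr.
elim: lDz => [_|p p' i lp [y [ky pE lx]] p'0 kpp' pi p'i].
  exists 0; rewrite blowup0 !subr0; split=> //; first by rewrite /kerZ /= mulmx0.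
  by apply: linked_refl; exact: nonneg_vpos.
have [e ke eE] := kblow_surj bg kpp'.
have [y' ky' p'E] : exists2 y' : 'cV[int]_q, kerZ A' y' &
    p' = vpos (blowup b g z) - blowup b g y'.
  exists (y + e); first exact: kerZD.
  by rewrite blowupD -eE opprD addrA -pE opprB addrC subrK.
exists y'; split=> //.
have p0 := linked_nonneg lp; have x0 := linked_nonneg lx.
set x := vpos z - y in lx x0; set x' := vpos z - y'.
have entryP w j : 0 < g j -> (vpos (blowup b g z) - blowup b g w) j 0 =
    g j * (vpos z - w) (b j) 0.
  by move=> gj; rewrite !mxE; exact: pos_scale_entry.
have entryN w j : g j < 0 -> (vpos (blowup b g z) - blowup b g w) j 0 =
    (- g j) * (`|z (b j) 0| - (vpos z - w) (b j) 0).
  by move=> gj; rewrite !mxE; exact: neg_scale_entry.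
have x'0 : nonneg x'.
  move=> k; have [j <- gj] := kblow_pos bg k.
  by have := p'0 j; rewrite p'E entryP // pmulr_rge0.
have kxx' : kerZ A' (x - x').
  by rewrite opprB addrC addrA subrK; exact: kerZB.
have [gi|gi|gi0] := ltgtP 0 (g i); last first.
- by have := kblow_neq0 bg i; rewrite -gi0 eqxx.
- have [[k [zk x'k]]|dz] := pselect (exists k, 0 < vpos z k 0 /\ 0 < x' k 0).
    apply: linked_rcons (linked_refl _ (nonneg_vpos z)) x'0 _ zk x'k.
    by rewrite opprB addrC subrK.
  have [[k [xk x'k]]|dx] := pselect (exists k, 0 < x k 0 /\ 0 < x' k 0).
    exact: linked_rcons lx x'0 kxx' xk x'k.
  exfalso; pose t := column (b i).
  (* By [column_neg] every coordinate of the column has a negative copy, where nonnegativity of [p]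
     and [p'] reads as these bounds. *)
  have bnd k : column k == t -> x k 0 <= `|z k 0| /\ x' k 0 <= `|z k 0|.
    move=> /eqP/(column_neg gi)[j <- gj].
    have := p0 j; have := p'0 j; rewrite pE p'E !entryN //.
    by rewrite !pmulr_rge0 ?oppr_gt0 // !subr_ge0.
  have disj k : ~ (0 < Num.max (z k 0) 0 /\ 0 < x' k 0) /\
      ~ (0 < x k 0 /\ 0 < x' k 0).
    split=> h; last by apply: dx; exists k.
    by apply: dz; exists k; rewrite mxE.
  have xV k : x k 0 = Num.max (z k 0) 0 - y k 0 by rewrite subvE mxE.
  have x'V k : x' k 0 = Num.max (z k 0) 0 - y' k 0 by rewrite subvE mxE.
  (* Disjointness from [vpos z] and the bound give [y' - z >= 0] on the column; its sum is zero, so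
     it vanishes there. *)
  have x'E k : column k == t -> x' k 0 = Num.max (- z k 0) 0.
    move=> kt.
    have /psumr_eq0P-/(_ _ k kt) h : \sum_(j | column j == t) (y' - z) j 0 = 0.
      by apply: column_sum; exact: kerZB.
    have : (y' - z) k 0 = 0.
      apply: h => j jt; have [_ xj] := bnd j jt; have [dj _] := disj j.
      by have := x'0 j; rewrite x'V in xj dj *; rewrite subvE; lia.
    by rewrite x'V subvE; lia.
  (* The same argument for [y], now using that [x] is disjoint from the negative part of [z]. *)
  have xE k : column k == t -> x k 0 = Num.max (z k 0) 0.
    move=> kt.
    have /psumr_eq0P-/(_ _ k kt) h : \sum_(j | column j == t) y j 0 = 0.
      exact: column_sum.
    rewrite xV h ?subr0 // => j jt.
    have [xj _] := bnd j jt; have [_ dj] := disj j; have x'j := x'E j jt.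
    by have := x0 j; rewrite x'j xV in xj dj *; lia.
  have bt : column (b i) == t by [].
  (* Positivity of [p] and [p'] at [i] would make both the negative and the positive part of one
     entry of [z] positive. *)
  move: pi p'i; rewrite pE p'E !entryN // !pmulr_rgt0 ?oppr_gt0 //.
  by rewrite -/x -/x' (xE _ bt) (x'E _ bt); lia.
- apply: (linked_rcons (i := b i) lx x'0 kxx').
    by move: pi; rewrite pE entryP // pmulr_rgt0.
  by move: p'i; rewrite p'E entryP // pmulr_rgt0.
Qed.

End KernelBlowup.

(** * Lawrence liftings *)

Section Lawrence.
Variable r : nat.

Definition lblock n (s : 'I_(\sum_(i < r) n)) : 'I_r := tagnat.sig1 s.
Definition lcoord n (s : 'I_(\sum_(i < r) n)) : 'I_n := tagnat.sig2 s.
Definition lrank n (i : 'I_r) (k : 'I_n) : 'I_(\sum_(i < r) n) :=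
  tagnat.Rank i k.

Lemma lblockK n i (k : 'I_n) : lblock (lrank i k) = i.
Proof. exact: tagnat.Rank1K. Qed.

Lemma lcoordK n i (k : 'I_n) : lcoord (lrank i k) = k.
Proof. by apply: val_inj; rewrite /lcoord /lrank tagnat.Rank2K. Qed.

Lemma lrankK n (s : 'I_(\sum_(i < r) n)) : lrank (lblock s) (lcoord s) = s.
Proof. exact: tagnat.sig2K. Qed.

Lemma submxcol_lrank n (u : 'cV[int]_(\sum_(i < r) n)) i k :
  submxcol u i k 0 = u (lrank i k) 0.
Proof. by rewrite mxE. Qed.

Lemma kerZ_lawrence_column_sum m n (A : 'M[int]_(m, n)) u :
  kerZ (lawrence r A) u ->
  forall k, \sum_(s | lcoord s == k) u s 0 = 0.
Proof.
move=> /kerZ_lawrence[_ /colP u0] k; have := u0 k; rewrite mxE summxE => {2}<-.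
rewrite (reindex (fun i => lrank i k)) /=.
  apply: eq_big => [i|i _]; first by rewrite lcoordK eqxx.
  by rewrite submxcol_lrank.
exists (@lblock n) => [i _|s]; first exact: lblockK.
by rewrite inE => /eqP <-; exact: lrankK.
Qed.

Lemma pointed_lawrence m n (A : 'M[int]_(m, n)) : pointed (lawrence r A).
Proof.
move=> t t0 /kerZ_lawrence_column_sum sum0; apply/colP => s; rewrite mxE.
by have /psumr_eq0P := sum0 (lcoord s); apply.
Qed.

Variables (m n m' q : nat) (A : 'M[int]_(m, n)) (A' : 'M[int]_(m', q)).
Variables (b : 'I_n -> 'I_q) (g : 'I_n -> int).
Hypothesis bg : kernel_blowup A A' b g.

Let lb s := lrank (lblock s) (b (lcoord s)).
Let lg (s : 'I_(\sum_(i < r) n)) := g (lcoord s).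

Lemma submxcol_blowup u i :
  submxcol (blowup lb lg u) i = blowup b g (submxcol u i).
Proof.
apply/colP => k; rewrite submxcol_lrank [LHS]mxE [RHS]mxE submxcol_lrank.
by rewrite /lb /lg lcoordK lblockK.
Qed.

Lemma lawrence_type_blowup u : lawrence_type (blowup lb lg u) = lawrence_type u.
Proof.
apply: eq_card => i; rewrite !inE submxcol_blowup; congr negb.
apply/eqP/eqP => [/(blowup_eq0 bg)//|->]; exact: blowup0.
Qed.

Lemma kernel_blowup_lawrence :
  kernel_blowup (lawrence r A) (lawrence r A') lb lg.
Proof.
split.
- by move=> s; exact: kblow_neq0 bg _.
- move=> s; have [i bi gi] := kblow_pos bg (lcoord s).
  exists (lrank (lblock s) i); last by rewrite /lg lcoordK.
  by rewrite /lb lcoordK lblockK bi lrankK.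
- move=> u /kerZ_lawrence[ku su]; apply/kerZ_lawrence; split=> [i|].
    by rewrite submxcol_blowup; exact: kblow_ker bg _ _.
  rewrite -[RHS](blowup0 b g) -su blowup_sum.
  by apply: eq_bigr => i _; exact: submxcol_blowup.
- move=> v /kerZ_lawrence[kv sv].
  have /fin_all_exists[f fP] i :
      exists u, kerZ A' u /\ submxcol v i = blowup b g u.
    by have [u] := kblow_surj bg (kv i); exists u.
  have fE i : submxcol (\mxcol_i f i) i = f i by rewrite mxcolK.
  exists (\mxcol_i f i).
    apply/kerZ_lawrence; split=> [i|]; first by rewrite fE; case: (fP i).
    (* The rows were lifted independently; injectivity of the blow-up makes the lifts sum to
       zero. *)
    apply: (blowup_eq0 bg); rewrite blowup_sum -[RHS]sv.
    by apply: eq_bigr => i _; rewrite fE; case: (fP i).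
  rewrite -[LHS]submxcolK -[RHS]submxcolK; apply/eq_mxcolP => i.
  by rewrite submxcol_blowup fE; case: (fP i).
Qed.

Lemma universal_markov_blowup z : universal_markov_basis (lawrence r A') z ->
  universal_markov_basis (lawrence r A) (blowup lb lg z).
Proof.
move=> [M minM Mz].
have kz : kerZ (lawrence r A') z by case: minM => -[_ MA _] _; exact: MA.
apply: unlinked_universal_markov => //; first exact: pointed_lawrence.
  exact: kblow_ker kernel_blowup_lawrence _ kz.
move=> lDz; apply: (minimal_markov_unlinked _ minM Mz).
  exact: pointed_lawrence.
apply: (linked_blowup kernel_blowup_lawrence _ _ kz lDz (column := @lcoord q)).
  exact: kerZ_lawrence_column_sum.
move=> s j gs jE; exists (lrank (lblock j) (lcoord s)).
  by rewrite /lb lcoordK lblockK -[RHS]lrankK jE /lb lcoordK.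
by rewrite /lg lcoordK.
Qed.

End Lawrence.

Lemma markov_complexity_blowup m n m' q (A : 'M[int]_(m, n))
    (A' : 'M[int]_(m', q)) b g :
  kernel_blowup A A' b g ->
  (markov_complexity A' <= markov_complexity A)%E.
Proof.
move=> bg; have [+ _] := markov_complexity_le A (markov_complexity A).
move=> /(_ (lexx _))[mA0 mA]; apply/markov_complexity_le; split=> // t.
move=> [r [u [r2 Uu ->]]]; apply: mA; exists r.
exists (blowup (fun s => lrank (lblock s) (b (lcoord s)))
               (fun s => g (lcoord s)) u).
split=> //; first exact: (universal_markov_blowup bg).
by rewrite (lawrence_type_blowup bg).
Qed.

(** * Bouquets *)

Lemma biggcdz_ge0 (I : Type) (s : seq I) (P : pred I) (F : I -> int) :
  0 <= \big[gcdz/0]_(i <- s | P i) F i.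
Proof. by elim/big_rec: _. Qed.

Lemma dvdz_biggcdz (I : eqType) (s : seq I) (P : pred I) (F : I -> int) i :
  i \in s -> P i -> (\big[gcdz/0]_(j <- s | P j) F j %| F i)%Z.
Proof.
elim: s => // j s IH; rewrite inE big_cons => /predU1P[<- -> |/IH{}IH Pi].
  exact: dvdz_gcdl.
case: ifP => _; last exact: IH.
exact: dvdz_trans (dvdz_gcdr _ _) (IH Pi).
Qed.

Lemma biggcdz_bezout (I : finType) (P : pred I) (F : I -> int) :
  exists e : I -> int, \sum_(i | P i) e i * F i = \big[gcdz/0]_(i | P i) F i.
Proof.
pose K x := exists e : I -> int, \sum_(i | P i) e i * F i = x.
apply: (big_ind K) => [|x y [e <-] [f <-]|i Pi].
- by exists (fun=> 0); apply: big1 => i _; rewrite mul0r.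
- have [u [v <-]] := Bezoutz (\sum_(i | P i) e i * F i)
                              (\sum_(i | P i) f i * F i).
  exists (fun i => u * e i + v * f i); rewrite !mulr_sumr -big_split /=.
  by apply: eq_bigr => i _; ring.
- exists (fun j => (j == i)%:R); rewrite (bigD1 i) //= eqxx mul1r big1 ?addr0 //.
  by move=> j /andP[_ /negPf ->]; rewrite mul0r.
Qed.

Section Proportional.
Variables (m n : nat) (A : 'M[int]_(m, n)).

(** Dependence of two Gale rows with nonzero coefficients, stated without choosing a kernel
    basis. *)
Definition proportional (i j : 'I_n) : Prop :=
  exists a b : int, [/\ a != 0, b != 0 &
    forall v, kerZ A v -> a * v i 0 = b * v j 0].

Lemma adjacent_proportional i j : adjacent A i j -> proportional i j.
Proof.
move=> [ij [w wE]]; exists ((w *m A) 0 i), (- (w *m A) 0 j).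
split; [by rewrite wE eqxx|by rewrite oppr_eq0 wE eqxx orbT|] => v kv.
have /matrixP/(_ 0 0) : (w *m A) *m v = 0 by rewrite -mulmxA kv mulmx0.
rewrite [LHS]mxE [RHS]mxE (bigD1 i) //= (bigD1 j) 1?eq_sym //=.
rewrite big1 => [|k /andP[ki kj]].
  by rewrite addr0 => /eqP; rewrite addr_eq0 mulNr => /eqP.
have /eqP -> : (w *m A) 0 k == 0; last by rewrite mul0r.
by rewrite -[_ == _]negbK wE (negPf ki) (negPf kj).
Qed.

Lemma connect_proportional i j :
  connect (fun i j => `[< adjacent A i j >]) i j -> proportional i j.
Proof.
move=> /connectP[p + ->]; elim: p i => [|k p IH] i /=; first by exists 1, 1.
move=> /andP[/asboolP/adjacent_proportional[a [b [a0 b0 ab]]]].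
move=> /IH[c [d [c0 d0 cd]]]; exists (c * a), (b * d).
split; rewrite ?mulf_neq0 // => v kv.
by rewrite -mulrA ab // mulrCA cd // mulrA.
Qed.

Lemma proportional_cross i j v w : proportional i j -> kerZ A v -> kerZ A w ->
  v i 0 * w j 0 = v j 0 * w i 0.
Proof.
move=> [a [b [a0 b0 ab]]] kv kw; apply: (mulfI a0).
by rewrite mulrA ab // mulrCA ab //; ring.
Qed.

Lemma bouquets_partition : finset.partition (bouquets A) [set: 'I_n]%SET.
Proof.
apply: equivalence_partitionP => i j k _ _ _; split; first exact: connect0.
move=> ij; apply/idP/idP; last exact: connect_trans.
apply: connect_trans; rewrite sym_connect_sym // => x y.
by apply/asboolP/asboolP; exact: adjacent_sym.
Qed.

Lemma bouquet_proportional B i j :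
  B \in bouquets A -> i \in B -> j \in B -> proportional i j.
Proof.
move=> /imsetP[x _ ->]; rewrite !inE /= => xi xj.
apply: connect_proportional; apply: connect_trans xj.
rewrite sym_connect_sym // => y z.
by apply/asboolP/asboolP; exact: adjacent_sym.
Qed.

End Proportional.

Section BouquetVector.
Variables (m n d : nat) (A : 'M[int]_(m, n)) (G : 'M[int]_(n, d)).
Hypothesis galeG : gale_matrix A G.
Variables (B : {set 'I_n}) (c : 'cV[int]_n).
Hypotheses (BA : B \in bouquets A) (cB : bouquet_cvec G B c).

Lemma gale_col_ker j : kerZ A (col j G).
Proof. by apply/(galeG.1); exists (delta_mx j 0); rewrite colE. Qed.

Lemma nonfree_cvecP j (g := \big[gcdz/0]_(i in B) G i j) i0 :
  (forall i, i \in B -> G i j != 0) -> i0 \in B ->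
  0 < g /\ forall i, i \in B ->
    ((Num.sg (G i0 j) * G i j) %/ g)%Z * g = Num.sg (G i0 j) * G i j.
Proof.
move=> GB i0B.
have dvg i : i \in B -> (g %| G i j)%Z.
  by move=> iB; apply: dvdz_biggcdz => //; exact: mem_index_enum.
split=> [|i iB]; last by rewrite divzK // dvdz_mull // dvg.
rewrite lt_def biggcdz_ge0 andbT; apply: contraTneq (dvg _ i0B) => ->.
by rewrite dvd0z; exact: GB.
Qed.

Lemma bouquet_cvec_supp i : (c i 0 != 0) = (i \in B).
Proof.
have [fB|nfB] := pselect (free_bouquet G B); first by have [] := cB.1 fB.
have [j [i0 [GB [i0B _] cE]]] := cB.2 nfB; rewrite cE.
case: ifP => [iB|_]; last by rewrite eqxx.
have [g0 gE] := nonfree_cvecP GB i0B.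
apply/negP => /eqP c0; have := gE i iB; rewrite c0 mul0r => /esym/eqP.
by rewrite mulf_eq0 sgr_eq0 (negPf (GB _ i0B)) (negPf (GB _ iB)).
Qed.

Lemma bouquet_cvec_pos : exists i, 0 < c i 0.
Proof.
have [fB|nfB] := pselect (free_bouquet G B).
  by have [_ [i [ci _]]] := cB.1 fB; exists i.
have [j [i0 [GB [i0B _] cE]]] := cB.2 nfB; exists i0; rewrite cE i0B.
have [g0 gE] := nonfree_cvecP GB i0B.
by rewrite -(pmulr_lgt0 _ g0) gE // -normrEsg normr_gt0; exact: GB.
Qed.

Lemma bouquet_cvec_factor v : kerZ A v ->
  exists x : int, forall i, i \in B -> v i 0 = c i 0 * x.
Proof.
move=> kv; have [fB|nfB] := pselect (free_bouquet G B).
  exists 0 => i iB; have [y ->] := (galeG.1 v).1 kv.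
  have := fB i iB => /rowP Gi0; rewrite mulr0 mxE big1 // => k _.
  by have := Gi0 k; rewrite !mxE => ->; rewrite mul0r.
have [j [i0 [GB [i0B _] cE]]] := cB.2 nfB.
have [g0 gE] := nonfree_cvecP GB i0B.
have [e eE] := biggcdz_bezout [in B] (G ^~ j).
(* The Bezout coefficients of the gcd, applied to [v], give the multiplier; this is where its
   integrality comes from. *)
exists (Num.sg (G i0 j) * \sum_(k in B) e k * v k 0) => i iB.
apply: (mulIf (lt0r_neq0 g0)); rewrite cE iB mulrAC gE //.
rewrite mulrCA !mulrA -expr2 sqr_sg GB // mul1r -eE !mulr_sumr.
apply: eq_bigr => k kB.
have := proportional_cross (bouquet_proportional BA iB kB) kv (gale_col_ker j).
by rewrite !mxE mulrCA => ->; ring.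
Qed.

End BouquetVector.

Lemma bouquet_kernel_blowup m n q (A : 'M[int]_(m, n)) (AB : 'M[int]_(m, q)) :
  bouquet_matrix A AB -> exists b g, kernel_blowup A AB b g.
Proof.
move=> [d [G [B [c [galeG permB cB colAB]]]]].
have BA k : tnth B k \in bouquets A.
  by rewrite -mem_enum -(perm_mem permB) mem_tnth.
have /and3P[/eqP covA trivA _] := bouquets_partition A.
have Binj : injective (tnth B).
  by apply/tuple_uniqP; rewrite (perm_uniq permB) enum_uniq.
have /fin_all_exists[b bP] i : exists k, i \in tnth B k.
  have : i \in finset.cover (bouquets A) by rewrite covA inE.
  rewrite -mem_pblock => iP.
  have : finset.pblock (bouquets A) i \in B.
    by rewrite (perm_mem permB) mem_enum pblock_mem // -mem_pblock.
  by move=> /tnthP[k kE]; exists k; rewrite -kE.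
have bE i k : (i \in tnth B k) = (k == b i).
  apply/idP/eqP => [ik|->]; last exact: bP.
  by apply: Binj; rewrite -(def_pblock trivA (BA k) ik); apply: def_pblock.
have suppc k i : (c k i 0 != 0) = (k == b i).
  by rewrite (bouquet_cvec_supp (cB k)) bE.
exists b, (fun i => c (b i) i 0).
have mulAB u : AB *m u = A *m blowup b (fun i => c (b i) i 0) u.
  (* Row [i] of the matrix with columns [c k] has its only nonzero entry at [b i], so this matrix
     acts as the blow-up. *)
  have -> : AB = A *m \matrix_(i, k) c k i 0.
    apply/matrixP => l k; have := colAB k => /colP/(_ l); rewrite !mxE => ->.
    by rewrite summxE; apply: eq_bigr => i _; rewrite !mxE mulrC.
  rewrite -mulmxA; congr (_ *m _); apply/colP => i; rewrite !mxE.
  rewrite (bigD1 (b i)) //= mxE big1 ?addr0 // => k kb.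
  have /eqP c0 : c k i 0 == 0 by rewrite -[_ == _]negbK suppc (negPf kb).
  by rewrite mxE c0 mul0r.
split.
- by move=> i; rewrite suppc.
- move=> k; have [i ci] := bouquet_cvec_pos (cB k).
  have /eqP ki : k == b i by rewrite -suppc gt_eqF.
  by exists i; rewrite -ki.
- by move=> u; rewrite /kerZ /= mulAB.
- move=> v kv.
  have /fin_all_exists[f fP] k := bouquet_cvec_factor galeG (BA k) (cB k) kv.
  have vE : v = blowup b (fun i => c (b i) i 0) (\col_k f k).
    by apply/colP => i; rewrite !mxE; apply: fP.
  by exists (\col_k f k); rewrite // /kerZ /= mulAB -vE.
Qed.

Theorem theorem3p6 (m n q : nat) (A : 'M[int]_(m, n)) (AB : 'M[int]_(m, q))
    (hAB : bouquet_matrix A AB) :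
  (markov_complexity AB <= markov_complexity A)%E.
Proof.
have [b [g bg]] := bouquet_kernel_blowup hAB.
exact: markov_complexity_blowup bg.
Qed.
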